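(* Let $H$ be a finite dimensional real or complex Hilbert space with $\dim H = n$. For every positive integer $N$, every contraction $T$ on $H$ has an $N$-minimal unitary $N$-dilation acting on a space of dimension $n + N d_T$. This dilation is also minimal.
   Context: A contraction is a linear operator $T$ with $\|T\| \le 1$. For a contraction $T$ on $H$, put $D_T = (I - T^*T)^{1/2}$, $\mathcal{D}_T = \mathrm{Im}(D_T)$ and $d_T = \dim \mathcal{D}_T$. A unitary $N$-dilation for an operator $T$ on $H$ is a unitary $U$ acting on a Hilbert space $K \supseteq H$ (over the same scalar field) such that $T^k = P_H U^k P_H$ (as operators on $H$) for all $k = 1, \ldots, N$, where $P_H$ is the orthogonal projection of $K$ onto $H$. The dilation $U$ on $K$ is called $N$-minimal if $K = \mathrm{span}\{U^k h : h \in H,\ k = 0, \ldots, N\}$. It is called minimal if the smallest subspace $L \subseteq K$ such that $H \subseteq L$ and $UL = L$ is $K$ itself. *)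

(* Defs.v *)
From HB Require Import structures.
From mathcomp Require Import all_boot all_order all_algebra.
From mathcomp Require Import sesquilinear.
From mathcomp Require Import complex.
From mathcomp Require Import boolp classical_sets reals.

Set Implicit Arguments.
Unset Strict Implicit.
Unset Printing Implicit Defensive.

Import Order.TTheory GRing.Theory Num.Theory.
Local Open Scope ring_scope.
Local Open Scope classical_set_scope.

Inductive scalar_kind := RealScalars | ComplexScalars.

Definition scalars (R : realType) (s : scalar_kind) : numFieldType :=
  match s with RealScalars => R | ComplexScalars => R[i] end.

Definition sconj (R : realType) (s : scalar_kind) :
    involutive_rmorphism (scalars R s) :=
  match s return involutive_rmorphism (scalars R s) with
  | RealScalars => @idfun R
  | ComplexScalars => @Num.conj R[i]
  end.

Definition sRe (R : realType) (s : scalar_kind) : scalars R s -> R :=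
  match s return scalars R s -> R with
  | RealScalars => id
  | ComplexScalars => @complex.Re R
  end.

(* Inner products are linear in their first argument. Finite-dimensional inner
   product spaces over R or R[i] are complete, hence are Hilbert spaces. *)
Notation inner_product R s H := {dot H for sconj R s}.

Section Operators.
Context (R : realType) (s : scalar_kind) (H : vectType (scalars R s)).
Context (f : inner_product R s H).
Implicit Types (T A U : 'End(H)) (W : {vspace H}).

Definition hnorm (x : H) : R := Num.sqrt (sRe (f x x)).

Definition opnorm T : R :=
  sup [set hnorm (T x) | x in [set x | hnorm x <= 1]].

Definition contraction T : Prop := opnorm T <= 1.

(* The default value 0 is never taken; see [adjointP]. *)
Definition adjoint T : 'End(H) :=
  xget 0 [set S : 'End(H) | forall x y, f (T x) y = f x (S y)].

Lemma adjointP T x y : f (T x) y = f x (adjoint T y).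
Proof.
suff [S SP] : exists S : 'End(H), forall u v, f (T u) v = f u (S v).
  by apply: (@xgetPex _ (0 : 'End(H)) [set S : 'End(H) | forall x y, f (T x) y = f x (S y)]); exists S.
set n := \dim {:H}; pose e (i : 'I_n) : H := (vbasis {:H})`_i.
pose G : 'M_n := \matrix_(i, j) f (e i) (e j).
have eE u : u = \sum_i coord (vbasis {:H}) i u *: e i.
  exact/coord_vbasis/memvf.
have Gu : G \in unitmx.
  rewrite -row_free_unit -kermx_eq0; apply/eqP/row_matrixP => i.
  rewrite row0; set v := row i _.
  have vG : v *m G = 0 by rewrite -row_mul mulmx_ker row0.
  pose w := \sum_j v 0 j *: e j.
  have we j : f w (e j) = 0.
    rewrite linear_sumlz.
    have := congr1 (fun M : 'rV_n => M 0 j) vG; rewrite mxE [RHS]mxE => vGj.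
    rewrite -[RHS]vGj; apply: eq_bigr => k _.
    by rewrite linearZl_LR /= [G k j]mxE.
  have w0 : w = 0.
    apply/eqP; apply: contraT => wn0; case/eqP: (lt0r_neq0 (neq0_dnorm_gt0 (s := f) w wn0)).
    rewrite [X in f _ X](eE w) linear_sumr big1 // => j _.
    by rewrite linearZr_LR /= we mulr0.
  apply/rowP => j; rewrite [RHS]mxE.
  have /freeP/(_ (fun j => v 0 j) w0 j) := basis_free (vbasisP {:H}).
  by [].
pose c y j := sconj R s (\sum_i invmx G j i * f (T (e i)) y).
pose S0 y := \sum_j c y j *: e j.
have S0lin : linear S0.
  move=> a u v; rewrite /S0 scaler_sumr -big_split /=; apply: eq_bigr => j _.
  rewrite scalerA -scalerDl; congr (_ *: _).
  rewrite /c -[a in RHS](rmorphK (sconj R s)) -rmorphM -rmorphD; congr (sconj R s _).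
  rewrite mulr_sumr -big_split; apply: eq_bigr => i _ /=.
  by rewrite linearPr /= mulrDr mulrCA.
pose S1 : {linear H -> H} := HB.pack S0 (GRing.isLinear.Build _ _ _ _ S0 S0lin).
exists (linfun S1) => u v; rewrite lfunE /= {1 2}(eE u).
rewrite linear_sum !linear_sumlz; apply: eq_bigr => i _.
rewrite linearZ !linearZl_LR; congr (_ * _).
rewrite linear_sumr.
transitivity ((G *m (invmx G *m \col_i f (T (e i)) v)) i 0).
  by rewrite mulKVmx // mxE.
rewrite mxE; apply: eq_bigr => j _.
rewrite linearZr_LR /= rmorphK mulrC !mxE; congr (_ * _).
by apply: eq_bigr => k _; rewrite mxE.
Qed.

(* Self-adjointness does not follow from the inequality over the reals. *)
Definition positive_op A : Prop :=
  adjoint A = A /\ forall x, 0 <= f (A x) x.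

(* The positive square root of A: a positive A has exactly one, and the default
   value 0 is taken only if A is not positive. *)
Definition sqrt_op A : 'End(H) :=
  xget 0 [set S : 'End(H) | positive_op S /\ (S \o S)%VF = A].

Definition defect_op T : 'End(H) := sqrt_op (\1%VF - (adjoint T \o T)%VF).

Definition defect_space T : {vspace H} := limg (defect_op T).

Definition defect_index T : nat := \dim (defect_space T).

Definition unitary U : Prop :=
  (adjoint U \o U)%VF = \1%VF /\ (U \o adjoint U)%VF = \1%VF.

Definition ortho_proj W : 'End(H) := daddv_pi W (orthov f W).

Definition op_pow T (k : nat) : 'End(H) := iter k (comp_lfun T) \1%VF.

End Operators.

(* The inclusion of H in K is given by an isometric embedding J, so that the
   subspace H of K is limg J. *)
Section Dilations.
Context (R : realType) (s : scalar_kind).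
Context (H K : vectType (scalars R s)).
Context (fH : inner_product R s H) (fK : inner_product R s K).
Context (J : 'Hom(H, K)).

Definition unitary_dilation (N : nat) (T : 'End(H)) (U : 'End(K)) : Prop :=
  [/\ isometry fK fH J,
      unitary fK U &
      forall k : nat, (1 <= k <= N)%N -> let P := ortho_proj fK (limg J) in
        (J \o op_pow T k)%VF = (P \o op_pow U k \o P \o J)%VF].

Definition N_minimal (N : nat) (U : 'End(K)) : Prop :=
  fullv = (\sum_(k < N.+1) op_pow U k @: limg J)%VS.

Definition least_reducing (U : 'End(K)) (L : {vspace K}) : Prop :=
  [/\ (limg J <= L)%VS, (U @: L)%VS = L &
      forall M : {vspace K}, (limg J <= M)%VS -> (U @: M)%VS = M -> (L <= M)%VS].

Definition minimal_dilation (U : 'End(K)) : Prop := least_reducing U fullv.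

End Dilations.

(* Main.v *)
(* Let D be the positive square root of 1 - T^* T, so that
   |T h|^2 + |D h|^2 = |h|^2. On K = H + (Im D)^N the map
     V (h, x_1, ..., x_N) = (T h, D h, x_1, ..., x_(N-1))
   is isometric on the subspace M = {x_N = 0}, hence extends from M to a unitary
   U of the finite-dimensional space K. Whatever the extension, for k <= N the
   vector U^k h is (T^k h, D T^(k-1) h, ..., D h, 0, ..., 0), because the first N
   applications of U are to vectors of M. The first component gives the dilation
   property; the component D h in position k sweeps the k-th copy of Im D, so
   H, U H, ..., U^N H span K by triangularity, and any U-invariant space containing H is K.

   The square root comes from an orthonormal eigenbasis, uniformly for real and
   complex scalars: only the existence of one eigenvector of a self-adjoint
   operator needs a case distinction. *)
From HB Require Import structures.
Require Import Defs.
From mathcomp Require Import all_boot all_order all_algebra.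
From mathcomp Require Import sesquilinear complex spectral.
From mathcomp Require Import boolp classical_sets reals.
From mathcomp Require Import ring.

Set Implicit Arguments.
Unset Strict Implicit.
Unset Printing Implicit Defensive.

Import Order.TTheory GRing.Theory Num.Theory.
Local Open Scope ring_scope.

(** * Scalar facts uniform in the real and complex cases *)

Section Scalars.
Context (R : realType) (s : scalar_kind).
Implicit Types a b : scalars R s.

Lemma mul_sconj a : a * sconj R s a = `|a| ^+ 2.
Proof.
case: s a => /= a; first by rewrite real_normK ?num_real.
by rewrite normCK.
Qed.

Lemma sconj_ge0 a : 0 <= a -> sconj R s a = a.
Proof.
case: s a => //= a a0; exact/CrealP/ger0_real.
Qed.

Lemma scalars_sqrt a : 0 <= a -> exists2 r, 0 <= r & r * r = a.
Proof.
case: s a => /= a a0.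
  by exists (Num.sqrt a); rewrite ?sqrtr_ge0 // -expr2 sqr_sqrtr.
by exists (sqrtC a); rewrite ?sqrtC_ge0 // -expr2 sqrtCK.
Qed.

Lemma le_sRe a b : a <= b -> sRe a <= sRe b.
Proof. by case: s a b => //= a b; rewrite lecE => /andP[]. Qed.

Lemma sRe_le1 a : 0 <= a -> (sRe a <= 1) = (a <= 1).
Proof.
case: s a => //= a; rewrite !lecE /= => /andP[/eqP -> _].
by rewrite eqxx.
Qed.

End Scalars.

(** * Operators on an invariant subspace, in coordinates *)

Section BasisCoordinates.
Context (F : fieldType) (H : vectType F) (W : {vspace H}) (A : 'End(H)).
Hypothesis AW : (A @: W <= W)%VS.

Let m := \dim W.

Definition vec_of_row (u : 'rV[F]_m) : H := \sum_i u 0 i *: (vbasis W)`_i.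

Definition mx_of_stable : 'M[F]_m :=
  \matrix_(i, j) coord (vbasis W) j (A (vbasis W)`_i).

Lemma vec_of_row_mem u : vec_of_row u \in W.
Proof.
apply: memv_suml => i _.
by rewrite memvZ // vbasis_mem // mem_nth // size_tuple.
Qed.

Lemma vec_of_row_eq0 u : (vec_of_row u == 0) = (u == 0).
Proof.
apply/eqP/eqP => [u0|->]; last first.
  by rewrite /vec_of_row big1 // => i _; rewrite mxE scale0r.
apply/rowP => j; rewrite mxE.
by have /freeP/(_ (fun j => u 0 j) u0 j) := basis_free (vbasisP W).
Qed.

Lemma vec_of_rowD u v : vec_of_row (u + v) = vec_of_row u + vec_of_row v.
Proof. by rewrite -big_split; apply: eq_bigr => i _; rewrite mxE scalerDl. Qed.

Lemma vec_of_rowZ a u : vec_of_row (a *: u) = a *: vec_of_row u.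
Proof. by rewrite scaler_sumr; apply: eq_bigr => i _; rewrite mxE scalerA. Qed.

(** Coordinate rows are multiplied on the right, so the row eigenvectors of [eigenvalueP] become
    eigenvectors of [A] in [W]. *)
Lemma vec_of_row_mul u : vec_of_row (u *m mx_of_stable) = A (vec_of_row u).
Proof.
have AE (i : 'I_m) : A (vbasis W)`_i = \sum_j mx_of_stable i j *: (vbasis W)`_j.
  have /coord_vbasis -> : A (vbasis W)`_i \in W.
    by apply: (subvP AW); rewrite memv_img // vbasis_mem // mem_nth // size_tuple.
  by apply: eq_bigr => j _; rewrite mxE.
rewrite /vec_of_row linear_sum /=.
under [RHS]eq_bigr => i _ do rewrite linearZ /= AE scaler_sumr.
rewrite exchange_big; apply: eq_bigr => j _ /=; rewrite mxE scaler_suml.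
by apply: eq_bigr => i _; rewrite scalerA.
Qed.

End BasisCoordinates.

Lemma complex_eigenvector (C : numClosedFieldType) (H : vectType C)
    (W : {vspace H}) (A : 'End(H)) :
  W != 0%VS -> (A @: W <= W)%VS ->
  exists a v, [/\ v \in W, v != 0 & A v = a *: v].
Proof.
rewrite -dimv_eq0 -lt0n => W0 AW.
have [a /eigenvalueP[u ua u0]] := eigenvalue_closed (mx_of_stable W A) W0.
exists a, (vec_of_row u); split; rewrite ?vec_of_row_mem ?vec_of_row_eq0 //.
by rewrite -vec_of_row_mul // ua vec_of_rowZ.
Qed.

(* If [u + i v] is an eigenvector of the complexified operator for [a + i b],
   comparing [f (A u) v] with [f u (A v)] gives [b * (f u u + f v v) = 0]. *)
Lemma real_eigenvector (R : realType) (H : vectType R)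
    (f : {dot H for @idfun R}) (W : {vspace H}) (A : 'End(H)) :
  (forall x y, f (A x) y = f x (A y)) ->
  W != 0%VS -> (A @: W <= W)%VS ->
  exists a v, [/\ v \in W, v != 0 & A v = a *: v].
Proof.
move=> Asym; rewrite -dimv_eq0 -lt0n => W0 AW.
pose M := mx_of_stable W A.
have [[a b] /eigenvalueP[w wab w0]] :=
  eigenvalue_closed (map_mx (real_complex R) M) W0.
pose u := map_mx (@complex.Re R) w; pose v := map_mx (@complex.Im R) w.
have ReD : {morph @complex.Re R : x y / x + y} by move=> [? ?] [? ?].
have ImD : {morph @complex.Im R : x y / x + y} by move=> [? ?] [? ?].
have wM j : (w *m map_mx (real_complex R) M) 0 j
    = Complex ((u *m M) 0 j) ((v *m M) 0 j).
  rewrite !mxE; apply/eqP; rewrite eq_complex /= (big_morph _ ReD erefl).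
  rewrite (big_morph _ ImD erefl); apply/andP; split; apply/eqP/eq_bigr => k _;
    rewrite !mxE; case: (w 0 k) => x y /=; ring.
have uM : u *m M = a *: u - b *: v.
  apply/rowP => j; have := wM j; rewrite wab mxE => wj.
  have := congr1 (@complex.Re R) wj; rewrite /= => <-.
  by rewrite !mxE; case: (w 0 j).
have vM : v *m M = b *: u + a *: v.
  apply/rowP => j; have := wM j; rewrite wab mxE => wj.
  have := congr1 (@complex.Im R) wj; rewrite /= => <-.
  by rewrite !mxE; case: (w 0 j) => x y /=; rewrite addrC.
pose L := vec_of_row (W := W).
have AL x : A (L x) = L (x *m M) by rewrite /L vec_of_row_mul.
have LB x y : L (x - y) = L x - L y.
  by rewrite -scaleN1r /L vec_of_rowD vec_of_rowZ scaleN1r.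
have b0 : b * (f (L u) (L u) + f (L v) (L v)) = 0.
  have := Asym (L u) (L v).
  rewrite !AL uM vM LB /L vec_of_rowD !vec_of_rowZ linearBl linearDr /=.
  rewrite !linearZl_LR !linearZr_LR /= => /eqP; rewrite -subr_eq0 => /eqP Z.
  by apply: oppr_inj; rewrite oppr0 -Z; ring.
(* Once [b] vanishes, whichever of [u] and [v] is nonzero yields the eigenvector. *)
have uv0 : (u != 0) || (v != 0).
  rewrite -negb_and; apply: contraNN w0 => /andP[/eqP u0 /eqP v0].
  apply/eqP/rowP => j; rewrite mxE; apply/eqP; rewrite eq_complex /=.
  have := congr1 (fun z : 'rV_ _ => z 0 j) u0.
  have := congr1 (fun z : 'rV_ _ => z 0 j) v0.
  by rewrite !mxE => -> ->; rewrite eqxx.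
have f_ge0 x : 0 <= f x x.
  by have [->|/(neq0_dnorm_gt0 (s := f))/ltW] := eqVneq x 0; rewrite ?linear0r.
have {}b0 : b = 0.
  move/eqP: b0; rewrite mulf_eq0 => /orP[/eqP //|]; rewrite paddr_eq0 //.
  move=> /andP[/eqP fu /eqP fv]; case/orP: uv0 => n0.
    have : 0 < f (L u) (L u) by apply: neq0_dnorm_gt0; rewrite vec_of_row_eq0.
    by rewrite fu ltxx.
  have : 0 < f (L v) (L v) by apply: neq0_dnorm_gt0; rewrite vec_of_row_eq0.
  by rewrite fv ltxx.
case/orP: uv0 => n0.
  exists a, (L u); split; rewrite ?vec_of_row_mem ?vec_of_row_eq0 //.
  by rewrite AL uM b0 scale0r subr0 /L vec_of_rowZ.
exists a, (L v); split; rewrite ?vec_of_row_mem ?vec_of_row_eq0 //.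
by rewrite AL vM b0 scale0r add0r /L vec_of_rowZ.
Qed.

(** * Finite-dimensional inner product spaces *)

Section InnerProduct.
Context (R : realType) (s : scalar_kind) (H : vectType (scalars R s)).
Context (f : inner_product R s H).
Implicit Types (T A U : 'End(H)) (W : {vspace H}).

Lemma dotC x y : f x y = sconj R s (f y x).
Proof. by rewrite (hermC f) mul1r. Qed.

Lemma dot_eq0_sym x y : f x y = 0 -> f y x = 0.
Proof. by rewrite (dotC y) => ->; rewrite rmorph0. Qed.

Lemma dot_ge0 x : 0 <= f x x.
Proof. by have [->|/(neq0_dnorm_gt0 (s := f))/ltW] := eqVneq x 0; rewrite ?linear0r. Qed.

Lemma dot_eq0 x : (f x x == 0) = (x == 0).
Proof.
apply/eqP/eqP => [fx|->]; last by rewrite linear0r.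
by apply: contra_eq fx => /(neq0_dnorm_gt0 (s := f)) /lt0r_neq0.
Qed.

Lemma dot_injr x y : (forall z, f z x = f z y) -> x = y.
Proof.
move=> xy; apply/eqP; rewrite -subr_eq0 -dot_eq0 linearBr /= xy.
by rewrite subrr.
Qed.

Lemma dot_mul_sconj x y : f x y * f y x = `|f x y| ^+ 2.
Proof. by rewrite (dotC y) mul_sconj. Qed.

Lemma dotZZ a x : f (a *: x) (a *: x) = `|a| ^+ 2 * f x x.
Proof. by rewrite linearZl_LR linearZr_LR /= mulrA mul_sconj. Qed.

Lemma exists_unit_multiple x : x != 0 ->
  exists r, [/\ 0 < r, r * r = f x x & f (r^-1 *: x) (r^-1 *: x) = 1].
Proof.
move=> x0; have [r r0 rr] := scalars_sqrt (dot_ge0 x).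
have rn0 : r != 0.
  by apply: contra_neq x0 => r0'; apply/eqP; rewrite -dot_eq0 -rr r0' mul0r.
exists r; split; rewrite ?lt0r ?rn0 // dotZZ -rr ger0_norm ?invr_ge0 //.
by rewrite exprVn expr2 mulVf ?mulf_neq0.
Qed.

(** Nondegeneracy of [f] pins down the operator picked by [xget]. *)
Lemma adjoint_unique T (S : 'End(H)) :
  (forall x y, f (T x) y = f x (S y)) -> adjoint f T = S.
Proof.
by move=> TS; apply/lfunP => y; apply: dot_injr => x; rewrite -adjointP.
Qed.

(** * Orthonormal eigenbases of self-adjoint operators *)

Definition self_adjoint A := forall x y, f (A x) y = f x (A y).

Lemma self_adjoint_eigenvector A W : self_adjoint A ->
  W != 0%VS -> (A @: W <= W)%VS ->
  exists a v, [/\ v \in W, f v v = 1 & A v = a *: v].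
Proof.
move=> Asym W0 AW.
suff [a [v [vW v0 Av]]] : exists a v, [/\ v \in W, v != 0 & A v = a *: v].
  have [r [_ _ rv]] := exists_unit_multiple v0.
  exists a, (r^-1 *: v); split; rewrite ?memvZ //.
  by rewrite linearZ /= Av !scalerA mulrC.
move: Asym; rewrite /self_adjoint => Asym.
(* All that depends on [s] is generalised, so that the scalars become [R] or [R[i]]. *)
case: s H f A W Asym W0 AW => /= V g B X Bsym X0 BX.
  exact: (@real_eigenvector R V g X B Bsym X0 BX).
exact: (@complex_eigenvector R[i] V X B X0 BX).
Qed.

(** Induction on the dimension of a stable [W]: a unit eigenvector [v] is split off, and
    self-adjointness keeps its orthogonal complement in [W] stable. *)
Lemma orthonormal_eigenbasis A : self_adjoint A ->
  forall m W, \dim W = m -> (A @: W <= W)%VS ->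
  exists (e : 'I_m -> H) (l : 'I_m -> scalars R s),
    [/\ forall i, e i \in W,
        forall i j, f (e i) (e j) = (i == j)%:R,
        forall i, A (e i) = l i *: e i &
        forall x, x \in W -> x = \sum_i f x (e i) *: e i].
Proof.
move=> Asym; elim=> [|m IHm] W dW AW.
  exists (fun=> 0), (fun=> 0); split; try by case.
  move/eqP: dW; rewrite dimv_eq0 => /eqP -> x; rewrite memv0 => /eqP ->.
  by rewrite big_ord0.
have W0 : W != 0%VS by rewrite -dimv_eq0 dW.
have [a [v [vW vv Av]]] := self_adjoint_eigenvector Asym W0 AW.
have memW' x : (x \in W :&: orthov f <[v]>)%VS = (x \in W) && (f x v == 0).
  by rewrite memv_cap mem_orthov1.
set W' := (W :&: orthov f <[v]>)%VS in memW'.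
(* [v] lies in [W] and is not orthogonal to itself, so the dimension drops by exactly one. *)
have dW' : \dim W' = m.
  rewrite -eq_dim_orthov1 ?dW //; apply/mem_orthovPn; exists v => //.
  by move: (oner_neq0 (scalars R s)); rewrite -vv.
have AW' : (A @: W' <= W')%VS.
  apply/subvP => _ /memv_imgP[x xW' ->]; move: xW'; rewrite !memW'.
  move=> /andP[xW /eqP xv]; rewrite (subvP AW) ?memv_img //=.
  by rewrite Asym Av linearZr_LR /= xv mulr0.
have [e [l [eW' ee Ae eE]]] := IHm W' dW' AW'.
have eW i : e i \in W by have := eW' i; rewrite memW' => /andP[].
have ev i : f (e i) v = 0 by have := eW' i; rewrite memW' => /andP[_ /eqP].
have ve i := dot_eq0_sym (ev i).
exists (fun i => if unlift ord0 i is Some j then e j else v).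
exists (fun i => if unlift ord0 i is Some j then l j else a).
split=> [i|i j|i|x xW].
- by case: unliftP.
- case: (unliftP ord0 i) => [i' ->|->]; case: (unliftP ord0 j) => [j' ->|->];
    rewrite ?ev ?ve ?vv ?ee ?eqxx //.
- by case: unliftP.
rewrite big_ord_recl unlift_none.
under eq_bigr do rewrite liftK.
have xW' : x - f x v *: v \in W'.
  by rewrite memW' memvB ?memvZ //= linearBl linearZl_LR /= vv mulr1 subrr.
rewrite -{1}[x](subrK (f x v *: v)) {1}(eE _ xW') addrC; congr (_ + _).
by apply: eq_bigr => i _; rewrite linearBl linearZl_LR /= ve mulr0 subr0.
Qed.

Lemma orthonormal_basis W : exists e : 'I_(\dim W) -> H,
    [/\ forall i, e i \in W,
        forall i j, f (e i) (e j) = (i == j)%:R &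
        forall x, x \in W -> x = \sum_i f x (e i) *: e i].
Proof.
have idP : self_adjoint \1%VF by move=> x y; rewrite !lfunE.
have [|e [l [eW ee _ eE]]] := orthonormal_eigenbasis idP (W := W) erefl.
  by rewrite lim1g.
by exists e.
Qed.

(** * Extension of isometries to unitaries *)

Definition rank_one (u w : H) : 'End(H) := linfun (fun x => f x u *: w).

Lemma rank_oneE u w x : rank_one u w x = f x u *: w.
Proof.
have lin : linear (fun x => f x u *: w).
  by move=> a y z; rewrite linearPl /= scalerDl scalerA.
pose L : {linear H -> H} :=
  HB.pack (fun x => f x u *: w) (GRing.isLinear.Build _ _ _ _ _ lin).
exact: (lfunE L x).
Qed.

(** One Gram-Schmidt step: a vector outside [W] minus its projection on [W], normalised. *)
Lemma exists_unit_orthogonal W : (\dim W < \dim {:H})%N ->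
  exists2 u, f u u = 1 & forall x, x \in W -> f x u = 0.
Proof.
move=> dW; have [e [eW ee eE]] := orthonormal_basis W.
have /subvPn[x _ xW] : ~~ (fullv <= W)%VS.
  by apply: contraTN dW => /dimvS; rewrite leqNgt.
pose u := x - \sum_i f x (e i) *: e i.
have u0 : u != 0.
  rewrite subr_eq0; apply: contraNneq xW => ->.
  by apply: memv_suml => i _; rewrite memvZ.
have ue i : f u (e i) = 0.
  rewrite linearBl linear_sumlz (bigD1 i) //= big1 ?addr0 => [|j ji].
    by rewrite linearZl_LR /= ee eqxx mulr1 subrr.
  by rewrite linearZl_LR /= ee (negPf ji) mulr0.
have [r [_ _ ru]] := exists_unit_multiple u0.
exists (r^-1 *: u) => // y /eE ->; rewrite linear_sumlz big1 // => i _.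
by rewrite linearZl_LR linearZr_LR /= (dot_eq0_sym (ue i)) !mulr0.
Qed.

(** Induction on the codimension of [M]: a unit vector orthogonal to [M] is sent to a unit vector
    orthogonal to the image of [M], which exists because [V] does not raise dimensions. *)
Lemma isometry_extension (V : 'End(H)) (M : {vspace H}) :
  (forall x y, x \in M -> y \in M -> f (V x) (V y) = f x y) ->
  exists U : 'End(H),
    (forall x, x \in M -> U x = V x) /\ (forall x y, f (U x) (U y) = f x y).
Proof.
move: {2}(_ - _)%N (erefl (\dim {:H} - \dim M)%N) => k.
elim: k V M => [|k IHk] V M dM isoV.
  have /eqP Mf : M == fullv by rewrite eqEdim subvf -subn_eq0 dM.
  by exists V; split=> // x y; apply: isoV; rewrite Mf memvf.
have ltM : (\dim M < \dim {:H})%N by rewrite -subn_gt0 dM.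
have [u uu uM] := exists_unit_orthogonal ltM.
have [|w ww wM] := exists_unit_orthogonal (W := (V @: M)%VS).
  by apply: leq_ltn_trans ltM; rewrite -(limg_ker_dim V M) leq_addl.
(* The correction vanishes on [M] and changes the value at [u] from [V u] to [w]. *)
pose V' := V + rank_one u (w - V u).
have V'M x : x \in M -> V' x = V x.
  by move=> xM; rewrite add_lfunE rank_oneE uM // scale0r addr0.
have V'u : V' u = w by rewrite add_lfunE rank_oneE uu scale1r addrC subrK.
have uNM : u \notin M.
  by apply/negP => /uM /eqP; rewrite uu oner_eq0.
have [||U [UV' isoU]] := IHk V' (M + <[u]>)%VS.
- rewrite dimv_disjoint_sum.
    rewrite dim_vline; have -> : u != 0 by apply: contraNneq uNM => ->; rewrite mem0v.
    by rewrite addn1 subnS dM.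
  apply/eqP; rewrite -subv0; apply/subvP => x /memv_capP[xM /vlineP[a xa]].
  move: (uM _ xM); rewrite xa linearZl_LR /= uu mulr1 => ->.
  by rewrite scale0r mem0v.
- move=> _ _ /memv_addP[x xM [_ /vlineP[a ->] ->]] /memv_addP[y yM [_ /vlineP[b ->] ->]].
  rewrite !linearD !linearZ /= V'u !V'M //.
  rewrite !(linearDl, linearDr, linearZl_LR, linearZr_LR) /= isoV // uu ww.
  rewrite !uM // !wM ?memv_img //.
  by rewrite !(dot_eq0_sym (uM _ _)) // !(dot_eq0_sym (wM _ _)) ?memv_img.
exists U; split=> // x xM; rewrite UV' ?V'M //.
by rewrite (subvP (addvSl _ _)).
Qed.

(** An injective [U] is invertible in finite dimension, so its left inverse [adjoint f U] is also a
    right inverse. *)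
Lemma isometric_unitary U : (forall x y, f (U x) (U y) = f x y) -> unitary f U.
Proof.
move=> isoU.
have UU x : adjoint f U (U x) = x.
  by apply: dot_injr => z; rewrite -adjointP isoU.
have kerU : lker U == 0%VS.
  apply/lker0P => x y Uxy; by rewrite -[x]UU Uxy UU.
split; apply/lfunP => y; rewrite comp_lfunE id_lfunE ?UU //.
by rewrite -{1}[y](lker0_lfunVK kerU) UU lker0_lfunVK.
Qed.

Lemma capv_orthov W : (W :&: orthov f W = 0)%VS.
Proof.
apply/eqP; rewrite -subv0; apply/subvP => y.
move=> /memv_capP[yW /mem_orthovP/(_ y yW)/eqP]; rewrite dot_eq0 => /eqP ->.
exact: mem0v.
Qed.

Lemma ortho_proj_id W x : x \in W -> ortho_proj f W x = x.
Proof. exact: daddv_pi_id (capv_orthov W). Qed.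

Lemma ortho_proj_perp W x : x \in orthov f W -> ortho_proj f W x = 0.
Proof.
move=> xW; have dW := capv_orthov W.
have := daddv_pi_add dW (subvP (addvSr W (orthov f W)) _ xW).
rewrite [X in _ + X]daddv_pi_id // 1?capvC // => /eqP.
by rewrite -subr_eq0 addrK => /eqP.
Qed.

(** * Positive square roots and the defect operator *)

Lemma sqrt_opP A : positive_op f A ->
  positive_op f (sqrt_op f A) /\ (sqrt_op f A \o sqrt_op f A)%VF = A.
Proof.
move=> [adjA posA].
(* Once a root exists, [xget] returns one and not the default [0]. *)
suff [S SP] : exists S, positive_op f S /\ (S \o S)%VF = A.
  apply: (@xgetPex _ (0 : 'End(H))
    [set S : 'End(H) | positive_op f S /\ (S \o S)%VF = A]%classic).
  by exists S.
have Asym : self_adjoint A by move=> x y; rewrite (adjointP f A) adjA.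
have [|e [l [_ ee Ae eE]]] := orthonormal_eigenbasis Asym (W := fullv) erefl.
  exact: subvf.
have l0 i : 0 <= l i.
  by have := posA (e i); rewrite Ae linearZl_LR /= ee eqxx mulr1.
pose r i := sval (cid2 (scalars_sqrt (l0 i))).
have r0 i : 0 <= r i by rewrite /r; case: cid2.
have rr i : r i * r i = l i by rewrite /r; case: cid2.
(* Same eigenvectors as [A], with square roots of its eigenvalues. *)
pose S : 'End(H) := \sum_i r i *: rank_one (e i) (e i).
have SE x : S x = \sum_i (r i * f x (e i)) *: e i.
  rewrite sum_lfunE; apply: eq_bigr => i _.
  by rewrite scale_lfunE rank_oneE scalerA.
exists S; split; first split.
- apply: adjoint_unique => x y; rewrite !SE linear_sumlz linear_sumr.
  apply: eq_bigr => i _; rewrite linearZl_LR linearZr_LR /= rmorphM (dotC (e i) y).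
  by rewrite /= (sconj_ge0 (r0 i)) mulrAC.
- move=> x; rewrite SE linear_sumlz; apply: sumr_ge0 => i _.
  rewrite linearZl_LR /= -mulrA dot_mul_sconj.
  by rewrite mulr_ge0 // exprn_ge0.
apply/lfunP => x; rewrite comp_lfunE SE [in RHS](eE x (memvf x)) linear_sum.
apply: eq_bigr => i _; rewrite linearZ /= Ae scalerA; congr (_ *: _).
rewrite SE linear_sumlz (bigD1 i) //= big1 ?addr0 => [|j ji].
  by rewrite linearZl_LR /= ee eqxx mulr1 mulrA rr mulrC.
by rewrite linearZl_LR /= ee (negPf ji) mulr0.
Qed.

(** The supremum bounds [T] on the unit ball, and scaling carries the bound to every [x]; the
    eigenbasis of [adjoint f T \o T] serves to show that the supremum is over a bounded set. *)
Lemma contraction_dot T x : contraction f T -> f (T x) (T x) <= f x x.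
Proof.
move=> cT; pose A := (adjoint f T \o T)%VF.
have fTT y z : f (T y) (T z) = f y (A z) by rewrite comp_lfunE -adjointP.
have Asym : self_adjoint A by move=> y z; rewrite -fTT dotC -fTT -dotC.
have [|e [l [_ ee Ae eE]]] := orthonormal_eigenbasis Asym (W := fullv) erefl.
  exact: subvf.
have fE y z : f y z = \sum_i f y (e i) * f (e i) z.
  rewrite {1}(eE y (memvf y)) linear_sumlz.
  by apply: eq_bigr => i _; rewrite linearZl_LR.
have l0 i : 0 <= l i.
  by have := dot_ge0 (T (e i)); rewrite fTT -Asym Ae linearZl_LR /= ee eqxx mulr1.
(* [sup] is 0 on unbounded sets, so [opnorm] carries information only once its
   defining set is known to be bounded. *)
have bnd y : f (T y) (T y) <= (\sum_i l i) * f y y.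
  rewrite fTT fE mulr_suml; apply: ler_sum => i _.
  rewrite -Asym Ae linearZl_LR /= mulrCA dot_mul_sconj ler_wpM2l //.
  rewrite [f y y]fE (bigD1 i) //= dot_mul_sconj ler_wpDr //.
  by apply: sumr_ge0 => j _; rewrite dot_mul_sconj exprn_ge0.
(* [f y y] is nonnegative, hence real, so [sRe] loses nothing. *)
have hnorm_le1 y : (hnorm f y <= 1) = (f y y <= 1).
  rewrite /hnorm -[1 in LHS](sqrtr1 R) ler_sqrt ?ltr01 // sRe_le1 //.
  exact: dot_ge0.
have fT1 y : f y y <= 1 -> f (T y) (T y) <= 1.
  move=> y1; rewrite -hnorm_le1; apply: le_trans cT.
  apply: ub_le_sup; last by exists y; rewrite //= hnorm_le1.
  exists (Num.sqrt (sRe (\sum_i l i))) => _ [z /= z1 <-].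
  rewrite /hnorm ler_wsqrtr // le_sRe // (le_trans (bnd z)) // ler_piMr //.
    exact: sumr_ge0.
  by rewrite -hnorm_le1.
have [->|x0] := eqVneq x 0; first by rewrite linear0 linear0r.
have [r [r0 rr rx]] := exists_unit_multiple x0.
have := fT1 (r^-1 *: x); rewrite rx lexx linearZ /= dotZZ.
rewrite ger0_norm ?invr_ge0 ?(ltW r0) // => /(_ isT).
by rewrite exprVn mulrC ler_pdivrMr ?exprn_gt0 // mul1r -rr expr2.
Qed.

(** Polarised form of the norm identity for [T] and its defect operator; contractivity makes [A]
    positive, hence the root genuine. *)
Lemma defect_op_dot T x y : contraction f T ->
  f (defect_op f T x) (defect_op f T y) = f x y - f (T x) (T y).
Proof.
move=> cT; pose A := (\1 - (adjoint f T \o T))%VF.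
have fA u v : f u (A v) = f u v - f (T u) (T v).
  by rewrite add_lfunE opp_lfunE id_lfunE comp_lfunE linearBr /= adjointP.
have Asym : self_adjoint A.
  move=> u v; rewrite dotC !fA rmorphB; congr (_ - _); exact/esym/dotC.
have posA : positive_op f A.
  split=> [|u]; first exact: adjoint_unique.
  by rewrite Asym fA subr_ge0 contraction_dot.
have [[adjS _] SS] := sqrt_opP posA.
set S := sqrt_op f A in adjS SS.
by rewrite -fA -[A in RHS]SS comp_lfunE adjointP adjS.
Qed.

End InnerProduct.

(** * The orthogonal sum of [H] and [N] copies of [D] *)

Section DirectSum.
Context (R : realType) (s : scalar_kind) (H : vectType (scalars R s)).
Context (f : inner_product R s H) (D : {vspace H}) (N : nat).

(** Each copy is the vector type [subvs_of D], so that it adds [\dim D] and not [\dim {:H}] to the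
    dimension. *)
Definition dsum : vectType (scalars R s) := (H * {ffun 'I_N -> subvs_of D})%type.

Implicit Types u v : dsum.

Definition dsum_dot u v : scalars R s :=
  f u.1 v.1 + \sum_i f (vsval (u.2 i)) (vsval (v.2 i)).

Fact dsum_dot_bilinear :
  bilinear_for *%R (sconj R s \; *%R) dsum_dot.
Proof.
split=> [v a x y|u a x y]; rewrite /dsum_dot /= mulrDr addrACA mulr_sumr -big_split /=.
  rewrite linearPl; congr (_ + _); apply: eq_bigr => i _.
  by rewrite !ffunE /= linearPl.
rewrite linearPr; congr (_ + _); apply: eq_bigr => i _.
by rewrite !ffunE /= linearPr.
Qed.

HB.instance Definition _ := bilinear_isBilinear.Build (scalars R s) dsum dsum
  (scalars R s) *%R (sconj R s \; *%R) dsum_dot dsum_dot_bilinear.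

Fact dsum_dot_hermitian u v :
  dsum_dot u v = (-1) ^+ false * sconj R s (dsum_dot v u).
Proof.
rewrite mul1r rmorphD rmorph_sum /dsum_dot /= (dotC f u.1); congr (_ + _).
by apply: eq_bigr => i _; rewrite (dotC f (vsval (u.2 i))).
Qed.

HB.instance Definition _ := isHermitianSesquilinear.Build (scalars R s) dsum
  false (sconj R s) dsum_dot dsum_dot_hermitian.

Fact dsum_dot_gt0 u : u != 0 -> 0 < dsum_dot u u.
Proof.
move=> u0; have ge0 x := dot_ge0 f x.
have S0 : 0 <= \sum_i f (vsval (u.2 i)) (vsval (u.2 i)) by apply: sumr_ge0.
rewrite lt0r addr_ge0 // andbT paddr_eq0 // psumr_eq0 //.
apply: contraNN u0 => /andP[]; rewrite dot_eq0 => /eqP u1 /allP u2.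
apply/eqP; rewrite [u]surjective_pairing u1; congr (_, _); apply/ffunP => i.
have /= := u2 i (mem_index_enum i); rewrite dot_eq0 ffunE => /eqP ui.
exact/val_inj.
Qed.

HB.instance Definition _ := isDotProduct.Build (scalars R s) dsum dsum_dot dsum_dot_gt0.

Definition dsum_inner : inner_product R s dsum := dsum_dot.

Lemma dim_dsum : \dim {:dsum} = (\dim {:H} + N * \dim D)%N.
Proof. by rewrite !dimvf -[X in (X * _)%N](card_ord N). Qed.

Definition dsum_in : 'Hom(H, dsum) := linfun (fun h => (h, 0) : dsum).

Lemma dsum_inE h : dsum_in h = (h, 0).
Proof.
have lin : linear (fun h => (h, 0) : dsum).
  by move=> a x y; congr (_, _); rewrite /= scaler0 addr0.
pose L : {linear H -> dsum} :=
  HB.pack (fun h => (h, 0) : dsum) (GRing.isLinear.Build _ _ _ _ _ lin).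
exact: (lfunE L h).
Qed.

Lemma dsum_in_isometry : isometry dsum_inner f dsum_in.
Proof.
move=> x y; rewrite !dsum_inE /= /dsum_dot /= big1 ?addr0 // => i _.
by rewrite ffunE linear0l.
Qed.

(** [(0, u.2)] is orthogonal to the copy of [H]. *)
Lemma dsum_proj u : ortho_proj dsum_inner (limg dsum_in) u = dsum_in u.1.
Proof.
have uE : u = dsum_in u.1 + ((0, u.2) : dsum).
  by rewrite dsum_inE [u in LHS]surjective_pairing; congr (_, _); rewrite ?addr0 ?add0r.
rewrite {1}uE linearD /= ortho_proj_id ?memv_img ?memvf //.
rewrite ortho_proj_perp ?addr0 /= //.
apply/mem_orthovP => _ /memv_imgP[h _ ->]; rewrite dsum_inE /= /dsum_dot /=.
by rewrite linear0l add0r big1 // => i _; rewrite ffunE linear0r.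
Qed.

End DirectSum.

(** * From a spanning orbit to minimality *)

Section Minimality.
Context (R : realType) (s : scalar_kind) (H K : vectType (scalars R s)).
Context (fK : inner_product R s K) (J : 'Hom(H, K)).

(** A subspace that contains [H] and equals its image under [U] contains every [U^k H], hence their
    span. *)
Lemma N_minimal_minimal (N : nat) (U : 'End(K)) :
  unitary fK U -> N_minimal J N U -> minimal_dilation J U.
Proof.
move=> [UU _] NU; split=> [||M JM UM]; first exact: subvf.
  (* Unitarity makes [U] injective, hence onto by dimension. *)
  apply/eqP; rewrite eqEdim subvf limg_dim_eq ?leqnn //.
  apply/eqP; rewrite -subv0; apply/subvP => x /memv_capP[_].
  rewrite memv_ker => /eqP Ux; have := congr1 (fun g : 'End(K) => g x) UU.
  by rewrite comp_lfunE Ux linear0 id_lfunE => <-; rewrite mem0v.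
rewrite NU; apply/subv_sumP => -[k /= _] _; elim: k => [|k IHk].
  by rewrite lim1g.
by rewrite limg_comp -UM limgS.
Qed.

End Minimality.

(** * The shift and the orbit of [H] *)

Section Dilation.
Context (R : realType) (s : scalar_kind) (H : vectType (scalars R s)).
Context (f : inner_product R s H) (T S : 'End(H)) (N : nat).
Hypothesis S_dot : forall x y, f (S x) (S y) = f x y - f (T x) (T y).

Local Notation D := (limg S).
Local Notation K := (dsum D N.+1).
Implicit Types (u v : K) (g : H).

(** Each component moves up one index and the one at [ord_max] is lost; the form [N.+1] makes that
    index exist. [vsproj] merely retypes [S u.1], which lies in [D]. *)
Definition shift_fun u : K :=
  (T u.1, [ffun i => if unlift ord0 i is Some j
                     then u.2 (widen_ord (leqnSn N) j)
                     else vsproj D (S u.1)]).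

Definition shift_op : 'End(K) := linfun shift_fun.

Lemma shift_opE u : shift_op u = shift_fun u.
Proof.
have lin : linear shift_fun.
  move=> a x y; congr (_, _); first by rewrite linearP.
  by apply/ffunP => i; rewrite !ffunE; case: unliftP => [j|] _;
    rewrite ?ffunE /= ?linearP.
pose L : {linear K -> K} := HB.pack shift_fun (GRing.isLinear.Build _ _ _ _ _ lin).
exact: (lfunE L u).
Qed.

(** Its kernel is the subspace on which the shift loses nothing. *)
Definition last_comp : 'Hom(K, subvs_of D) := linfun (fun u : K => u.2 ord_max).

Lemma last_compE u : last_comp u = u.2 ord_max.
Proof.
have lin : linear (fun u : K => u.2 ord_max) by move=> a x y; rewrite !ffunE.
pose L : {linear K -> subvs_of D} :=
  HB.pack (fun u : K => u.2 ord_max) (GRing.isLinear.Build _ _ _ _ _ lin).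
exact: (lfunE L u).
Qed.

(** The lost component is zero, and by [S_dot] the new one makes up for passing from [u.1] to
    [T u.1]. *)
Lemma shift_op_isometric u v : u \in lker last_comp -> v \in lker last_comp ->
  dsum_inner f D N.+1 (shift_op u) (shift_op v) = dsum_inner f D N.+1 u v.
Proof.
rewrite !memv_ker !last_compE => /eqP u0 /eqP v0.
rewrite !shift_opE /= /dsum_dot /= big_ord_recl !ffunE unlift_none.
rewrite !vsprojK ?memv_img ?memvf // S_dot addrA [X in X + _]addrC subrK.
rewrite [in RHS]big_ord_recr /= u0 linear0l addr0; congr (_ + _).
by apply: eq_bigr => i _; rewrite !ffunE liftK.
Qed.

Section Orbit.
Context (U : 'End(K)).
Hypothesis UM : forall u, u \in lker last_comp -> U u = shift_op u.

Lemma dilation_orbit g k : (k <= N.+1)%N ->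
  op_pow U k (dsum_in D N.+1 g) =
    (op_pow T k g, [ffun i : 'I_N.+1 => if (i < k)%N
                     then vsproj D (S (op_pow T (k - i.+1) g)) else 0]).
Proof.
elim: k => [|k IHk] kN.
  by rewrite !id_lfunE dsum_inE; congr (_, _); apply/ffunP => i; rewrite !ffunE.
rewrite !comp_lfunE -/(op_pow U k) -/(op_pow T k) IHk 1?ltnW // UM; last first.
  (* Only indices below [k] can carry nonzero components so far, and [k <= N] leaves out the last
     index [N]. *)
  by rewrite memv_ker last_compE ffunE /= ltnNge -ltnS kN.
rewrite shift_opE; congr (_, _); apply/ffunP => i; rewrite !ffunE /=.
case: unliftP => [j|] ->; last by rewrite subn1.
by rewrite ffunE lift0 /= ltnS subSS.
Qed.

Lemma orbit_N_minimal : N_minimal (dsum_in D N.+1) N.+1 U.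
Proof.
set J := dsum_in D N.+1; apply/esym/eqP; rewrite eqEsubv subvf; apply/subvP => u _.
set Z := (X in _ \in X).
have memZ k g : (k <= N.+1)%N -> op_pow U k (J g) \in Z.
  move=> kN; rewrite /Z.
  apply: (subvP (sumv_sup (Ordinal (kN : (k < N.+2)%N)) _ (subvv _))) => //=.
  by rewrite !memv_img ?memvf.
(* Triangular elimination: the components from index [j] on are assumed zero, and each step clears
   one more, down to a vector of [H]. *)
suff memZ_supp j v : (j <= N.+1)%N ->
    (forall i : 'I_N.+1, (j <= i)%N -> v.2 i = 0) -> v \in Z.
  by apply: (memZ_supp N.+1) => // i; rewrite leqNgt ltn_ord.
elim: j v => [|j IHj] v jN v0.
  have -> : v = op_pow U 0 (J v.1); last exact: memZ.
  rewrite id_lfunE dsum_inE [LHS]surjective_pairing; congr (_, _).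
  by apply/ffunP => i; rewrite v0 // ffunE.
(* [D] is the image of [S], so component [j] of [v] is some [S g]; this is also component [j] of
   [U^(j+1) g], whose later components vanish. *)
have /memv_imgP[g _ vj] := subvsP (v.2 (Ordinal jN)).
rewrite -[v](subrK (op_pow U j.+1 (J g))) memvD ?memZ //.
apply: IHj => [|i ji]; first exact: ltnW.
rewrite dilation_orbit // !ffunE /= ltnS.
have [ij|ij] := leqP i j; last by rewrite v0 // subr0.
have -> : i = Ordinal jN by apply/val_inj/eqP; rewrite eqn_leq ij.
by rewrite subnn id_lfunE -vj vsvalK subrr.
Qed.

(** The inner projection fixes [H], and the outer one keeps the first component [T^k g] of the
    orbit. *)
Lemma orbit_dilation k : (k <= N.+1)%N ->
  let P := ortho_proj (dsum_inner f D N.+1) (limg (dsum_in D N.+1)) in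
  (dsum_in D N.+1 \o op_pow T k)%VF
    = (P \o op_pow U k \o P \o dsum_in D N.+1)%VF.
Proof.
move=> kN P; apply/lfunP => g; rewrite !comp_lfunE /P.
by rewrite [X in op_pow U k X]ortho_proj_id ?memv_img ?memvf // dsum_proj dilation_orbit.
Qed.

End Orbit.

End Dilation.

Theorem theorem1p3 (R : realType) (s : scalar_kind)
    (H : vectType (scalars R s)) (fH : inner_product R s H)
    (n N : nat) (T : 'End(H)) :
  \dim {:H} = n -> (0 < N)%N -> contraction fH T ->
  exists (K : vectType (scalars R s)) (fK : inner_product R s K)
         (J : 'Hom(H, K)) (U : 'End(K)),
    [/\ unitary_dilation fH fK J N T U,
        N_minimal J N U,
        \dim {:K} = (n + N * defect_index fH T)%N &
        minimal_dilation J U].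
Proof.
(* Positivity of [N] gives the form [N.+1], so that there is a last copy for the shift to drop. *)
move=> <-; case: N => // N _ cT.
have S_dot x y := defect_op_dot x y cT.
have [U [UM isoU]] := isometry_extension (shift_op_isometric (N := N) S_dot).
have unitU := isometric_unitary isoU.
have minU := orbit_N_minimal UM.
exists (dsum (defect_space fH T) N.+1), (dsum_inner fH _ _), (dsum_in _ _), U.
split=> //.
- split=> //; first exact: dsum_in_isometry.
  by move=> k /andP[_]; apply: orbit_dilation.
- exact: dim_dsum.
exact: N_minimal_minimal unitU minU.
Qed.
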